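(* There exist a dimension $n$, a convex body $K\subset\mathbb{R}^n$ with nonempty interior, and a real number $\lambda$ with $-\mathrm{r}(K;B_n)<\lambda<0$ such that $$K_\lambda+|\lambda|\,(K_\lambda)^*\subsetneq K,$$ i.e. $K$ strictly contains $K_\lambda+|\lambda|(K_\lambda)^*$. Here $K_\lambda$ is the inner parallel body of $K$ at distance $|\lambda|$ relative to the Euclidean unit ball $B_n$, and $(K_\lambda)^*$ is the form body of $K_\lambda$ with respect to $B_n$.
   Context: A convex body in $\mathbb{R}^n$ is a nonempty compact convex set. $B_n$ is the closed Euclidean unit ball of $\mathbb{R}^n$ and $\mathbb{S}^{n-1}$ the unit sphere. Sums of sets are Minkowski sums. Inradius: $\mathrm{r}(K;B_n)=\sup\{r\ge 0:\exists\,x\in\mathbb{R}^n \text{ with } x+rB_n\subseteq K\}$. Inner parallel bodies: for $-\mathrm{r}(K;B_n)\le\lambda\le 0$, $K_\lambda=\{x\in\mathbb{R}^n: x+|\lambda|B_n\subseteq K\}$. Extreme normal vectors: for a convex body $L$, a vector $u\in\mathbb{S}^{n-1}$ is a ($0$-)extreme normal vector of $L$ if it cannot be written as a linear combination with positive coefficients of two linearly independent (outer) normal vectors of $L$ at one and the same boundary point of $L$. $\mathcal{U}(L)$ denotes the set of all extreme normal vectors of $L$. Form body (with respect to $B_n$): for a convex body $L$ with nonempty interior, $L^*=\{x\in\mathbb{R}^n:\langle x,u\rangle\le 1 \text{ for all } u\in\mathcal{U}(L)\}$. For $-\mathrm{r}(K;B_n)<\lambda\le 0$ the body $K_\lambda$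 has nonempty interior, so $(K_\lambda)^*$ is defined. *)

(* Defs.v *)
From mathcomp Require Import all_boot all_order all_algebra.
From mathcomp Require Import all_classical all_reals all_analysis.

Set Implicit Arguments.
Unset Strict Implicit.
Unset Printing Implicit Defensive.

Import Order.TTheory GRing.Theory Num.Theory.
Import numFieldNormedType.Exports.

Local Open Scope classical_set_scope.
Local Open Scope ring_scope.

(* R^n is 'rV[R]_n. The library norm on 'rV[R]_n is the sup norm; it is used
   here only through the topology it induces (compactness, interior, closure),
   while all metric notions go through the Euclidean norm enorm. *)

Definition dotp (R : realType) (n : nat) (u v : 'rV[R]_n) : R :=
  \sum_(i < n) u ord0 i * v ord0 i.

Definition enorm (R : realType) (n : nat) (u : 'rV[R]_n) : R :=
  Num.sqrt (dotp u u).

Definition eball (R : realType) (n : nat) : set 'rV[R]_n :=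
  [set x | enorm x <= 1].

Arguments eball : clear implicits.

Definition esphere (R : realType) (n : nat) : set 'rV[R]_n :=
  [set u | enorm u = 1].

Arguments esphere : clear implicits.

Definition minkowski_sum (R : realType) (n : nat) (A B : set 'rV[R]_n) :
    set 'rV[R]_n :=
  [set x + y | x in A & y in B].

Definition dilate (R : realType) (n : nat) (r : R) (A : set 'rV[R]_n) :
    set 'rV[R]_n :=
  [set r *: x | x in A].

Definition convex_body (R : realType) (n : nat) (K : set 'rV[R]_n) : Prop :=
  [/\ K !=set0, compact K & convex_set K].

(* For K bounded and nonempty in positive dimension this is a genuine
   supremum; in dimension 0 the set is unbounded and sup is 0 by convention. *)
Definition inradius (R : realType) (n : nat) (K : set 'rV[R]_n) : R :=
  sup [set r : R | 0 <= r /\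
    exists x : 'rV[R]_n, minkowski_sum [set x] (dilate r (eball R n)) `<=` K].

Definition inner_parallel (R : realType) (n : nat) (K : set 'rV[R]_n)
    (lambda : R) : set 'rV[R]_n :=
  [set x | minkowski_sum [set x] (dilate `|lambda| (eball R n)) `<=` K].

Definition bdry (R : realType) (n : nat) (L : set 'rV[R]_n) : set 'rV[R]_n :=
  closure L `\` interior L.

Definition outer_normal (R : realType) (n : nat) (L : set 'rV[R]_n)
    (x u : 'rV[R]_n) : Prop :=
  u != 0 /\ forall y, L y -> dotp (y - x) u <= 0.

Definition extreme_normals (R : realType) (n : nat) (L : set 'rV[R]_n) :
    set 'rV[R]_n :=
  [set u | esphere R n u /\
    ~ exists (x v w : 'rV[R]_n) (a b : R),
        [/\ bdry L x,
            outer_normal L x v /\ outer_normal L x w,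
            free [:: v; w],
            0 < a /\ 0 < b &
            u = a *: v + b *: w]].

Definition form_body (R : realType) (n : nat) (L : set 'rV[R]_n) :
    set 'rV[R]_n :=
  [set x | forall u, extreme_normals L u -> dotp x u <= 1].

(* Main.v *)
Require Import Defs.
From mathcomp Require Import all_boot all_order all_algebra.
From mathcomp Require Import all_classical all_reals all_analysis.
From mathcomp Require Import ring lra.

Set Implicit Arguments.
Unset Strict Implicit.
Unset Printing Implicit Defensive.

Import Order.TTheory GRing.Theory Num.Theory.
Import numFieldNormedType.Exports.

Local Open Scope classical_set_scope.
Local Open Scope ring_scope.

(** A polytope with facet normals [u_i] and heights [h_i + t] has the polytope
    with the same normals and heights [h_i] as its inner parallel body at
    distance [t], as soon as the [u_i] are unit vectors.  If moreover every
    [u_i] is the normal of an actual facet of the latter, then every [u_i] is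
    extreme and the form body lies in the polytope with heights [1], so that
    the Minkowski sum is contained in the original polytope.  The inclusion is
    strict when the inner body and its form body are not strongly isomorphic:
    for a roof whose four slopes have two different inclinations, the heights
    can be chosen so that the ridge of the inner body is parallel to the
    y-axis while that of its form body is parallel to the x-axis, and then the
    sum does not reach the ridge of the original roof. *)

(** * Euclidean inner product *)

Section Dotp.
Context {R : realType} {n : nat}.
Implicit Types (x y u : 'rV[R]_n) (a : R).

Lemma dotpDl x y u : dotp (x + y) u = dotp x u + dotp y u.
Proof.
by rewrite /dotp -big_split; apply: eq_bigr => i _; rewrite mxE mulrDl.
Qed.

Lemma dotpZl a x u : dotp (a *: x) u = a * dotp x u.
Proof.
by rewrite /dotp mulr_sumr; apply: eq_bigr => i _; rewrite mxE mulrA.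
Qed.

Lemma dotpC x y : dotp x y = dotp y x.
Proof. by apply: eq_bigr => i _; rewrite mulrC. Qed.

Lemma dotpBl x y u : dotp (x - y) u = dotp x u - dotp y u.
Proof. by rewrite dotpDl -scaleN1r dotpZl mulN1r. Qed.

Lemma dotp_ge0 x : 0 <= dotp x x.
Proof. by apply: sumr_ge0 => i _; rewrite -expr2 sqr_ge0. Qed.

Lemma esphereE u : esphere R n u -> dotp u u = 1.
Proof.
by move=> u1; rewrite -[LHS]sqr_sqrtr ?dotp_ge0// -/(enorm u) u1 expr1n.
Qed.

Lemma eball_dotp x : eball R n x -> dotp x x <= 1.
Proof.
move=> x1; rewrite -[leLHS]sqr_sqrtr ?dotp_ge0//.
by rewrite exprn_ile1// ?sqrtr_ge0.
Qed.

(** Cauchy-Schwarz in the form needed here, read off from [0 <= dotp (x - u) (x - u)]. *)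
Lemma eball_dotp_le1 x u : eball R n x -> esphere R n u -> dotp x u <= 1.
Proof.
move=> /eball_dotp x1 /esphereE u1; have := dotp_ge0 (x - u).
by rewrite dotpBl !(dotpC _ (x - u)) !dotpBl u1 (dotpC u x); lra.
Qed.

Lemma continuous_dotp u : continuous (fun x => dotp x u).
Proof.
apply: continuous_big => [|i _ x]; first exact: add_continuous.
have cx : (fun z : 'rV[R]_n => z ord0 i) @ x --> x ord0 i.
  exact: coord_continuous.
exact: cvgMr_tmp cx.
Qed.

End Dotp.

(** * Polyhedra given by normals and heights *)

Definition polyhedron {R : realType} {n : nat} {I : finType}
    (u : I -> 'rV[R]_n) (h : I -> R) : set 'rV[R]_n :=
  [set x | forall i, dotp x (u i) <= h i].

Section Polyhedron.
Context {R : realType} {n : nat} {I : finType}.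
Context (u : I -> 'rV[R]_n).
Implicit Types (h : I -> R) (x : 'rV[R]_n).

Lemma closed_polyhedron h : closed (polyhedron u h).
Proof.
have -> : polyhedron u h =
    \bigcap_(i in setT) ((fun x => dotp x (u i)) @^-1` [set y | y <= h i]).
  by apply/seteqP; split=> x /= Hx i; [move=> _|]; apply: Hx.
apply: closed_bigI => i _; apply: preimage_closed; last exact: closed_le.
by move=> x _; apply: continuous_dotp.
Qed.

Lemma convex_polyhedron h : convex_set (polyhedron u h).
Proof.
move=> x y l; rewrite !inE => Hx Hy i.
have := Hx i; have := Hy i.
have l0 : 0 <= l%:num by [].
have l1 : 0 <= 1 - l%:num by rewrite subr_ge0.
move=> /(ler_wpM2l l1) yi /(ler_wpM2l l0) xi.
rewrite [dotp _ _](_ : _ = l%:num * dotp x (u i) + (1 - l%:num) * dotp y (u i)).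
  by move: (lerD xi yi); rewrite -mulrDl addrCA subrr addr0 mul1r.
by rewrite -!dotpZl -dotpDl.
Qed.

Lemma compact_polyhedron h (M : R) :
  (forall x, polyhedron u h x -> forall j, - M <= x ord0 j <= M) ->
  compact (polyhedron u h).
Proof.
move=> bnd.
have cube : compact [set x : 'rV[R]_n | forall j, x ord0 j \in `[- M, M]].
  apply: (@rV_compact _ _ (fun=> `[- M, M]%classic)).
  by move=> _; apply: segment_compact.
apply: subclosed_compact (@closed_polyhedron h) cube _ => x /bnd Mx j.
by rewrite in_itv; exact: Mx.
Qed.

Lemma interior_polyhedron h x :
  (forall i, dotp x (u i) < h i) -> interior (polyhedron u h) x.
Proof.
move=> Hx.
apply: (filter_forall (f := fun i y => dotp y (u i) <= h i) (nbhs_filter x)).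
move=> i; have lt_nbhs : nbhs (dotp x (u i)) [set y | y <= h i].
  apply: (@filterS _ _ _ [set y | y < h i]) => [y /ltW //|].
  by apply: open_nbhs_nbhs; split; [exact: open_lt|exact: Hx].
exact: (@continuous_dotp _ _ (u i) x _ lt_nbhs).
Qed.

Context (u1 : forall i, esphere R n (u i)).

(** For unit normals, the ball of radius [r] about [x] reaches farthest in direction [u i] at
    [x + r *: u i], where the inner product with [u i] exceeds that of [x] by exactly [r]. *)
Lemma ball_sub_polyhedron h x (r : R) : 0 <= r ->
  minkowski_sum [set x] (dilate r (eball R n)) `<=` polyhedron u h <->
  polyhedron u (fun i => h i - r) x.
Proof.
move=> r0; split=> [sub i|Hx].
  suff : dotp (x + r *: u i) (u i) <= h i.
    by rewrite dotpDl dotpZl (esphereE (u1 i)); lra.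
  apply: sub; exists x => //; exists (r *: u i) => //; exists (u i) => //.
  by rewrite /eball /= (u1 i).
move=> _ [_ -> [_ [b bB <-] <-]] i.
rewrite dotpDl dotpZl -lerBrDr (le_trans (Hx i))// lerB//.
by rewrite ler_piMr// eball_dotp_le1.
Qed.

Lemma inner_parallel_polyhedron h (t : R) : 0 <= t ->
  inner_parallel (polyhedron u h) (- t) = polyhedron u (fun i => h i - t).
Proof.
move=> t0; rewrite /inner_parallel normrN (ger0_norm t0).
by apply/seteqP; split=> x /(ball_sub_polyhedron _ _ t0).
Qed.

(* If [u i = a *: v + b *: w] with [v], [w] normals at [x], then [v] and [w]
   are constant on the facet, hence both are multiples of [u i]. *)
Lemma facet_normal_extreme h i (p : 'rV[R]_n) :
  polyhedron u h p -> dotp p (u i) = h i ->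
  (forall v, (forall q, polyhedron u h q -> dotp q (u i) = h i ->
                dotp (q - p) v = 0) -> exists c, v = c *: u i) ->
  extreme_normals (polyhedron u h) (u i).
Proof.
move=> Pp pF facet_span; split=> // -[x [v [w [a [b]]]]].
move=> [[clx _] [[_ xv] [w0 xw]] vwfree [a0 b0] uE].
have Px : polyhedron u h x by apply: closed_polyhedron.
(* On the facet, [dotp (q - x) (u i)] is nonnegative because [x] lies in the polyhedron; it is also
   a positive combination of two nonpositive numbers, so both vanish. *)
have normal_const q : polyhedron u h q -> dotp q (u i) = h i ->
    dotp (q - x) v = 0 /\ dotp (q - x) w = 0.
  move=> Pq qF; have := xv q Pq; have := xw q Pq.
  have : 0 <= dotp (q - x) (u i) by rewrite dotpBl subr_ge0 qF.
  rewrite [dotp _ (u i)](_ : _ = a * dotp (q - x) v + b * dotp (q - x) w);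
    last by rewrite uE !(dotpC (q - x)) dotpDl !dotpZl.
  move: (dotp (q - x) v) (dotp (q - x) w) => s r sr r0 s0.
  have as0 : a * s <= 0 by rewrite pmulr_rle0.
  have br0 : b * r <= 0 by rewrite pmulr_rle0.
  have /eqP : a * s = 0 by lra.
  have /eqP : b * r = 0 by lra.
  by rewrite !mulf_eq0 (gt_eqF a0) (gt_eqF b0) /= => /eqP -> /eqP ->.
have multiple z : (forall q, polyhedron u h q -> dotp q (u i) = h i ->
    dotp (q - x) z = 0) -> exists c, z = c *: u i.
  move=> Hz; apply: facet_span => q Pq qF.
  have := Hz _ Pq qF; have := Hz _ Pp pF.
  by rewrite !dotpBl; lra.
have [c vE] : exists c, v = c *: u i.
  by apply: multiple => q Pq /(normal_const _ Pq)[].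
have [d wE] : exists d, w = d *: u i.
  by apply: multiple => q Pq /(normal_const _ Pq)[].
have d0 : d != 0 by apply: contra_neq w0 => d0; rewrite wE d0 scale0r.
suff vw : v \in <[w]>%VS by move: vwfree; rewrite free_cons span_seq1 vw.
by apply/vlineP; exists (c / d); rewrite vE wE scalerA divfK.
Qed.

Lemma form_body_polyhedron_sub h :
  (forall i, extreme_normals (polyhedron u h) (u i)) ->
  form_body (polyhedron u h) `<=` polyhedron u (fun=> 1).
Proof. by move=> ext x Hx i; apply: Hx. Qed.

End Polyhedron.

(** * The explicit roof in dimension three *)

Section Roof.
Context {R : realType}.
Implicit Types (a b c : R) (x : 'rV[R]_3).

Definition vec3 a b c : 'rV[R]_3 := \row_(j < 3) [:: a; b; c]`_j.

Let i1 : 'I_3 := lift ord0 ord0.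

Lemma ord3P (j : 'I_3) : [\/ j = ord0, j = i1 | j = ord_max].
Proof.
by case: j => -[|[|[|//]]] lt; [constructor 1|constructor 2|constructor 3];
   apply: val_inj.
Qed.

Lemma dotp3 x a b c :
  dotp x (vec3 a b c) = x ord0 ord0 * a + x ord0 i1 * b + x ord0 ord_max * c.
Proof.
rewrite /dotp !big_ord_recr big_ord0 /= add0r !mxE /=.
by congr (x _ _ * _ + x _ _ * _ + x _ _ * _); apply/val_inj.
Qed.

Lemma dotp_vec3 a b c x :
  dotp (vec3 a b c) x = a * x ord0 ord0 + b * x ord0 i1 + c * x ord0 ord_max.
Proof. by rewrite dotpC dotp3 !(mulrC (x _ _)). Qed.

(** A floor and two pairs of opposite slopes; the Pythagorean triple 3, 4, 5 makes the normals both
    unit and rational. *)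
Definition roof_normal (i : 'I_5) : 'rV[R]_3 :=
  [:: vec3 0 0 (-1);
      vec3 (4 / 5) 0 (3 / 5); vec3 (- (4 / 5)) 0 (3 / 5);
      vec3 0 (3 / 5) (4 / 5); vec3 0 (- (3 / 5)) (4 / 5)]`_i.

(* Pairs of opposite slopes meet at height [h_i / (u_i)_z]: the inner body has
   its ridge at height [min (3 / (3/5)) (8 / (4/5)) = 5], the form body at
   [min (1 / (3/5)) (1 / (4/5)) = 5/4], while the original roof reaches
   [min (4 / (3/5)) (9 / (4/5)) = 20/3 > 5 + 5/4]. *)
Definition roof_height (i : 'I_5) : R := [:: 1; 4; 4; 9; 9]`_i.

Lemma roof_normal_unit i : esphere R 3 (roof_normal i).
Proof.
apply/eqP; rewrite -(eqrXn2 (n := 2)) ?sqrtr_ge0// sqr_sqrtr ?dotp_ge0//.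
apply/eqP; case: i => -[|[|[|[|[|//]]]]] lt; rewrite dotp3 !mxE /=; by field.
Qed.

Lemma roofP (h : 'I_5 -> R) x (y := x ord0) :
  polyhedron roof_normal h x <->
  [/\ - y ord_max <= h (@Ordinal 5 0 isT),
      4 * y ord0 + 3 * y ord_max <= 5 * h (@Ordinal 5 1 isT),
      - 4 * y ord0 + 3 * y ord_max <= 5 * h (@Ordinal 5 2 isT),
      3 * y i1 + 4 * y ord_max <= 5 * h (@Ordinal 5 3 isT) &
      - 3 * y i1 + 4 * y ord_max <= 5 * h (@Ordinal 5 4 isT)].
Proof.
rewrite {}/y; split=> [H|[h0 h1 h2 h3 h4] i].
  have := H (@Ordinal 5 0 isT); have := H (@Ordinal 5 1 isT).
  have := H (@Ordinal 5 2 isT); have := H (@Ordinal 5 3 isT).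
  have := H (@Ordinal 5 4 isT).
  by rewrite /roof_normal /= !dotp3 => *; split; lra.
case: i => -[|[|[|[|[|//]]]]] lt; rewrite (bool_irrelevance lt isT);
  rewrite /roof_normal /= dotp3; lra.
Qed.

Lemma roof_facet i :
  extreme_normals (polyhedron roof_normal (fun i => roof_height i - 1))
    (roof_normal i).
Proof.
set L := polyhedron _ _.
(* Three affinely independent points of a facet suffice: a vector orthogonal to two independent
   edges is a multiple of the normal, and [c] reads the factor off one coordinate. *)
have facet3 p q r (c : 'rV[R]_3 -> R) : [/\ L p, L q & L r] ->
    [/\ dotp p (roof_normal i) = roof_height i - 1,
        dotp q (roof_normal i) = roof_height i - 1 &
        dotp r (roof_normal i) = roof_height i - 1] ->
    (forall v, dotp q v = dotp p v -> dotp r v = dotp p v ->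
       forall j, v ord0 j = c v * roof_normal i ord0 j) ->
    extreme_normals L (roof_normal i).
  move=> [Lp Lq Lr] [pF qF rF] span.
  apply: (facet_normal_extreme roof_normal_unit Lp pF) => v Hv.
  exists (c v); apply/rowP => j; rewrite mxE; apply: span;
    by apply/eqP; rewrite -subr_eq0 -dotpBl Hv.
case: i facet3 => -[|[|[|[|[|//]]]]] lt facet3;
  (* Each steep slope (cases 1 and 2) gets two points of the ridge and one of the base; each of the
     other two slopes gets two points of its base edge and one at height 1. *)
  [ apply: (facet3 (vec3 0 0 0) (vec3 1 0 0) (vec3 0 1 0)
      (fun v => - v ord0 ord_max))
  | apply: (facet3 (vec3 0 0 5) (vec3 0 1 5) (vec3 (15 / 4) 0 0)
      (fun v => 5 / 4 * v ord0 ord0))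
  | apply: (facet3 (vec3 0 0 5) (vec3 0 1 5) (vec3 (- (15 / 4)) 0 0)
      (fun v => - (5 / 4) * v ord0 ord0))
  | apply: (facet3 (vec3 0 (40 / 3) 0) (vec3 1 (40 / 3) 0) (vec3 0 12 1)
      (fun v => 5 / 3 * v ord0 i1))
  | apply: (facet3 (vec3 0 (- (40 / 3)) 0) (vec3 1 (- (40 / 3)) 0)
      (vec3 0 (- 12) 1) (fun v => - (5 / 3) * v ord0 i1)) ].
all: try by split; rewrite /L roofP /roof_height /= !mxE /=; split; lra.
all: try by split; rewrite /roof_normal /roof_height /= dotp3 !mxE /=; lra.
all: move=> v; rewrite !dotp_vec3 => ? ? j.
all: by rewrite /roof_normal; case: (ord3P j) => ->; rewrite !mxE /=; lra.
Qed.

Lemma inradius_roof : 1 < inradius (polyhedron roof_normal roof_height).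
Proof.
apply: (@lt_le_trans _ _ 2); first by rewrite ltr1n.
apply: ub_le_sup => [|/=].
  (* [sup] needs an upper bound: the floor and slopes 1 and 2 already force [8 * r <= 23]. *)
  exists 10 => r /= [r0 [x]].
  rewrite (ball_sub_polyhedron roof_normal_unit _ _ r0).
  by rewrite roofP /roof_height /= => -[*]; lra.
split; first exact: ler0n.
exists (vec3 0 0 1); apply/(ball_sub_polyhedron roof_normal_unit).
  exact: ler0n.
by rewrite roofP /roof_height /= !mxE /=; split; lra.
Qed.

Lemma convex_body_roof : convex_body (polyhedron roof_normal roof_height).
Proof.
split; last exact: convex_polyhedron.
- by exists 0; rewrite roofP /roof_height /= !mxE; split; lra.
- apply: (@compact_polyhedron _ _ _ _ _ 100) => x.
  rewrite roofP /roof_height /= => -[? ? ? ? ?].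
  by move=> j; case: (ord3P j) => ->; lra.
Qed.

End Roof.

Theorem proposition3p3 (R : realType) :
  exists (n : nat) (K : set 'rV[R]_n) (lambda : R),
    [/\ convex_body K,
        interior K !=set0,
        - inradius K < lambda < 0 &
        minkowski_sum (inner_parallel K lambda)
          (dilate `|lambda| (form_body (inner_parallel K lambda))) `<` K].
Proof.
pose K := polyhedron (@roof_normal R) roof_height.
pose L := polyhedron (@roof_normal R) (fun i => roof_height i - 1).
exists 3, K, (-1); rewrite normrN1.
have -> : inner_parallel K (-1) = L.
  exact: (inner_parallel_polyhedron roof_normal_unit _ ler01).
have form_sub := form_body_polyhedron_sub (@roof_facet R).
split; [exact: convex_body_roof| | |split].
- exists 0; apply: interior_polyhedron => i.
  rewrite -(scale0r 0) dotpZl mul0r.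
  by case: i => -[|[|[|[|[|//]]]]] lt; rewrite /roof_height /=; lra.
- by rewrite ltrN10 andbT ltrN2 inradius_roof.
(* The heights add up: [(roof_height i - 1) + 1]. *)
- move=> _ [x Lx [_ [y /form_sub Py <-] <-]] i.
  by have := Lx i; have := Py i; rewrite dotpDl dotpZl; lra.
(* The midpoint of the ridge of [K] is missed: the last coordinate is at most 5 on [L] (slopes 1 and
   2) and at most 5/4 on the form body (slopes 3 and 4). *)
- move=> /(_ (vec3 0 0 (20 / 3))) []; last move=> x Lx [_ [y /form_sub + <-]].
    by rewrite /K roofP /roof_height /= !mxE /=; split; lra.
  move: Lx; rewrite /L !roofP /roof_height /= => -[? ? ? ? ?] [? ? ? ? ?].
  by move=> /rowP/(_ ord_max); rewrite !mxE /=; lra.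
Qed.
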